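(* Let $\mathbb{F}$ be a field and let $q\in\mathbb{F}^*$ be not a root of unity. Let $m,n$ be positive integers with $\gcd(m,n)=1$, and let $f:\mathbb{Z}\to\mathbb{F}^*$ satisfy $f(i+n)=qf(i)$ for all $i\in\mathbb{Z}$. Let $\mathsf{V}^{m,n}_f$ be the representation of the quantum plane $\mathbb{F}_q[x,y]$ on $\mathbb{F}[t^{\pm1}]$ given by $x.t^i=t^{i+n}$, $y.t^i=f(i)t^{i-m}$, and let $\mathsf{s}_f(0)=\prod_{i=0}^{n-1}f(-im)$. (a) For $1\in\mathsf{V}^{m,n}_f$, the annihilator is $\mathsf{ann}_{\mathbb{F}_q[x,y]}(1)=\mathbb{F}_q[x,y]\left(x^my^n-\mathsf{s}_f(0)\right)$, and $$\mathsf{V}^{m,n}_f\simeq \mathbb{F}_q[x,y]/\mathbb{F}_q[x,y]\left(x^my^n-\mathsf{s}_f(0)\right)$$ as representations of $\mathbb{F}_q[x,y]$. (b) For positive integers $m',n'$ and $f':\mathbb{Z}\to\mathbb{F}^*$ satisfying $f'(i+n')=qf'(i)$ for all $i\in\mathbb{Z}$, we have $\mathsf{V}^{m,n}_f\simeq\mathsf{V}^{m',n'}_{f'}$ as representations of $\mathbb{F}_q[x,y]$ if and only if $m=m'$, $n=n'$ and $\mathsf{s}_{f'}(0)=q^k\mathsf{s}_f(0)$ for some $k\in\mathbb{Z}$, where $\mathsf{s}_{f'}(0)=\prod_{i=0}^{n'-1}f'(-im')$.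
   Context: $\mathbb{F}$ is a field of arbitrary characteristic, not necessarily algebraically closed, with group of units $\mathbb{F}^*$. The quantum plane is the unital associative algebra $\mathbb{F}_q[x,y]=\mathbb{F}\{x,y\}/(yx-qxy)$ with generators $x,y$ and relation $yx=qxy$. Representations are left modules. For positive integers $m,n$ and $f:\mathbb{Z}\to\mathbb{F}^*$ with $f(i+n)=qf(i)$ for all $i\in\mathbb{Z}$, $\mathsf{V}^{m,n}_f$ denotes the representation of $\mathbb{F}_q[x,y]$ on the space $\mathbb{F}[t^{\pm1}]$ of Laurent polynomials given by $x.t^i=t^{i+n}$, $y.t^i=f(i)t^{i-m}$ for all $i\in\mathbb{Z}$. For a representation $\mathsf{V}$ of $\mathbb{F}_q[x,y]$ and $v\in\mathsf{V}$, $\mathsf{ann}_{\mathbb{F}_q[x,y]}(v)=\{r\in\mathbb{F}_q[x,y]\mid r.v=0\}$, a left ideal. *)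

(* Defs.v *)
From HB Require Import structures.
From mathcomp Require Import all_boot all_order all_algebra.
From mathcomp Require Import boolp.
From mathcomp Require Import finmap.
From mathcomp Require Import monalg.

Set Implicit Arguments.
Unset Strict Implicit.
Unset Printing Implicit Defensive.

Import GRing.Theory.
Local Open Scope ring_scope.

(* The quotient of a module by a submodule; MathComp only provides its
   additive group. *)
Section QuotientModule.
Variables (R : pzRingType) (M : lmodType R) (N : submodClosed M).
Local Open Scope quotient_scope.

(* submodClosed does not record closure under opposites, which holds over a
   ring. *)
Definition lquot_sub : {pred M} := N.

HB.instance Definition _ := GRing.isZmodClosed.Build M lquot_sub
  (GRing.submod_closedB (submodClosedP N)).

Definition lquot : Type := Quotient.quot lquot_sub.

HB.instance Definition _ := GRing.Zmodule.on lquot.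

Definition lquot_pi (u : M) : lquot := \pi_(Quotient.quot lquot_sub) u.

Lemma lquot_piP u v : reflect (lquot_pi u = lquot_pi v) (u - v \in lquot_sub).
Proof. by rewrite Quotient.idealrBE; exact: eqP. Qed.

Lemma lquot_piD : {morph lquot_pi : u v / u + v}.
Proof. exact: (raddfD (\pi_(Quotient.quot lquot_sub))). Qed.

Lemma lquot_reprK (u : lquot) : lquot_pi (repr (u : Quotient.quot lquot_sub)) = u.
Proof. exact: reprK. Qed.

Definition lquot_scale (a : R) (u : lquot) : lquot :=
  lquot_pi (a *: repr (u : Quotient.quot lquot_sub)).

Lemma lquot_scaleE a u : lquot_scale a (lquot_pi u) = lquot_pi (a *: u).
Proof.
apply/lquot_piP; rewrite -scalerBr; apply: (@rpredZ _ _ N).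
by apply/lquot_piP; rewrite lquot_reprK.
Qed.

Fact lquot_scalerA a b u :
  lquot_scale a (lquot_scale b u) = lquot_scale (a * b) u.
Proof. by rewrite -[u]lquot_reprK !lquot_scaleE scalerA. Qed.

Fact lquot_scale1r : left_id 1 lquot_scale.
Proof. by move=> u; rewrite -[u]lquot_reprK lquot_scaleE scale1r. Qed.

Fact lquot_scalerDr : right_distributive lquot_scale +%R.
Proof.
move=> a u v; rewrite -[u]lquot_reprK -[v]lquot_reprK.
by rewrite -lquot_piD !lquot_scaleE scalerDr lquot_piD.
Qed.

Fact lquot_scalerDl u : {morph lquot_scale^~ u : a b / a + b}.
Proof.
by move=> a b; rewrite -[u]lquot_reprK !lquot_scaleE scalerDl lquot_piD.
Qed.

HB.instance Definition _ := GRing.Zmodule_isLmodule.Build R lquot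
  lquot_scalerA lquot_scale1r lquot_scalerDr lquot_scalerDl.

Lemma lquot_piZ a u : lquot_pi (a *: u) = a *: lquot_pi u.
Proof. by rewrite -lquot_scaleE. Qed.

End QuotientModule.

Section LeftIdeal.
Variables (R : pzRingType) (a : R).

Definition left_ideal : {pred R^o} := fun r => `[< exists b : R, r = b * a >].

Fact left_ideal_closed : submod_closed left_ideal.
Proof.
split=> [|c u v]; first by apply/asboolP; exists 0; rewrite mul0r.
move=> /asboolP[b ->] /asboolP[b' ->]; apply/asboolP.
by exists (c * b + b'); rewrite mulrDl -mulrA.
Qed.

HB.instance Definition _ :=
  GRing.isSubmodClosed.Build R R^o left_ideal (GRing.submod_closed_semi left_ideal_closed).

End LeftIdeal.

Definition annihilator (R : pzRingType) (V : lmodType R) (v : V) : {pred R} :=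
  fun r => r *: v == 0.

Definition rep_iso (R : pzRingType) (V W : lmodType R) : Prop :=
  exists phi : {linear V -> W}, bijective phi.

(* The quotient of a ring by the two-sided ideal generated by r;
   MathComp only has quotients of commutative rings. *)
Section TwoSidedQuotient.
Variables (R : pzRingType) (r : R).
Local Open Scope quotient_scope.

Definition ideal2 : {pred R} :=
  fun a => `[< exists s : seq (R * R), a = \sum_(p <- s) p.1 * r * p.2 >].

Fact ideal2_closed : zmod_closed ideal2.
Proof.
split=> [|u v]; first by apply/asboolP; exists [::]; rewrite big_nil.
move=> /asboolP[s ->] /asboolP[s' ->]; apply/asboolP.
exists (s ++ [seq (- p.1, p.2) | p <- s']).
rewrite big_cat big_map -sumrN /=; congr (_ + _).
by apply: eq_bigr => p _; rewrite !mulNr.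
Qed.

HB.instance Definition _ := GRing.isZmodClosed.Build R ideal2 ideal2_closed.

Lemma ideal2_gen : r \in ideal2.
Proof. by apply/asboolP; exists [:: (1, 1)]; rewrite big_seq1 mul1r mulr1. Qed.

Lemma ideal2Ml a u : u \in ideal2 -> a * u \in ideal2.
Proof.
move=> /asboolP[s ->]; apply/asboolP; exists [seq (a * p.1, p.2) | p <- s].
by rewrite big_map mulr_sumr; apply: eq_bigr => p _; rewrite !mulrA.
Qed.

Lemma ideal2Mr a u : u \in ideal2 -> u * a \in ideal2.
Proof.
move=> /asboolP[s ->]; apply/asboolP; exists [seq (p.1, p.2 * a) | p <- s].
by rewrite big_map mulr_suml; apply: eq_bigr => p _; rewrite !mulrA.
Qed.

Lemma ideal2_kernel (S : pzRingType) (ev : {rmorphism R -> S}) a :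
  ev r = 0 -> a \in ideal2 -> ev a = 0.
Proof.
move=> r0 /asboolP[s ->]; rewrite rmorph_sum big1 // => p _.
by rewrite !rmorphM r0 mulr0 mul0r.
Qed.

Definition rquot : Type := Quotient.quot ideal2.

HB.instance Definition _ := GRing.Zmodule.on rquot.

Definition rquot_pi (a : R) : rquot := \pi_(Quotient.quot ideal2) a.
Definition rquot_repr (a : rquot) : R := repr (a : Quotient.quot ideal2).

Lemma rquot_piP a b : reflect (rquot_pi a = rquot_pi b) (a - b \in ideal2).
Proof. by rewrite Quotient.idealrBE; exact: eqP. Qed.

Lemma rquot_piD : {morph rquot_pi : a b / a + b}.
Proof. exact: (raddfD (\pi_(Quotient.quot ideal2))). Qed.

Lemma rquot_pi0 : rquot_pi 0 = 0.
Proof. exact: (raddf0 (\pi_(Quotient.quot ideal2))). Qed.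

Lemma rquot_reprK : cancel rquot_repr rquot_pi.
Proof. by move=> a; exact: reprK. Qed.

(* Locked, here and below, only to keep unification from unfolding it. *)
Definition rquot_mul : rquot -> rquot -> rquot :=
  locked (fun a b => rquot_pi (rquot_repr a * rquot_repr b)).

Lemma rquot_mulE a b : rquot_mul (rquot_pi a) (rquot_pi b) = rquot_pi (a * b).
Proof.
rewrite /rquot_mul -lock; apply/rquot_piP.
set a' := rquot_repr _; set b' := rquot_repr _.
have -> : a' * b' - a * b = (a' - a) * b' + a * (b' - b).
  by rewrite mulrBl mulrBr addrA subrK.
by apply: rpredD; [apply: ideal2Mr | apply: ideal2Ml];
   apply/rquot_piP; exact: rquot_reprK.
Qed.

Fact rquot_mulA : associative rquot_mul.
Proof.
move=> a b c; rewrite -[a]rquot_reprK -[b]rquot_reprK -[c]rquot_reprK.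
by rewrite !rquot_mulE mulrA.
Qed.

Fact rquot_mul1r : left_id (rquot_pi 1) rquot_mul.
Proof. by move=> a; rewrite -[a]rquot_reprK rquot_mulE mul1r. Qed.

Fact rquot_mulr1 : right_id (rquot_pi 1) rquot_mul.
Proof. by move=> a; rewrite -[a]rquot_reprK rquot_mulE mulr1. Qed.

Fact rquot_mulDl : left_distributive rquot_mul +%R.
Proof.
move=> a b c; rewrite -[a]rquot_reprK -[b]rquot_reprK -[c]rquot_reprK.
by rewrite -rquot_piD !rquot_mulE mulrDl rquot_piD.
Qed.

Fact rquot_mulDr : right_distributive rquot_mul +%R.
Proof.
move=> a b c; rewrite -[a]rquot_reprK -[b]rquot_reprK -[c]rquot_reprK.
by rewrite -rquot_piD !rquot_mulE mulrDr rquot_piD.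
Qed.

HB.instance Definition _ := GRing.Zmodule_isPzRing.Build rquot
  rquot_mulA rquot_mul1r rquot_mulr1 rquot_mulDl rquot_mulDr.

Lemma rquot_piM : {morph rquot_pi : a b / a * b}.
Proof. by move=> a b; rewrite -rquot_mulE. Qed.

End TwoSidedQuotient.

(* The free algebra on two letters is the algebra of the free monoid on bool;
   the letter false stands for x and the letter true for y. *)
Notation free_alg F := {malg F[{fmonom bool}]}.

Section FreeAlgebra.
Variable F : fieldType.

Fact free_scalerAr (c : F) (a b : free_alg F) : c *: (a * b) = a * (c *: b).
Proof.
apply/malgP => k; rewrite [LHS]mcoeffZ [in LHS]mcoeffMr [RHS]mcoeffMr mulr_sumr.
have [->|c0] := eqVneq c 0.
  by rewrite scale0r msupp0 big_seq_fset0 big1 // => i _; rewrite mul0r.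
rewrite msuppZ (negPf c0); apply: eq_bigr => i _; rewrite mulr_sumr.
by apply: eq_bigr => j _; rewrite mcoeffZ mulrnAr mulrCA.
Qed.

Definition freeX : free_alg F := << fmu false >>.
Definition freeY : free_alg F := << fmu true >>.

Definition qrel (q : F) : free_alg F := freeY * freeX - q *: (freeX * freeY).

End FreeAlgebra.

(* Stated for an abstract algebra: rewriting between products of concrete
   elements of the free algebra makes unification unfold them. *)
Section AbstractAlgebra.
Variables (F : fieldType) (A : lalgType F).
Implicit Types a b : A.

Lemma rel_kernel (q : F) (ev : {rmorphism A -> F}) a b :
  (forall c d, ev (c *: d) = c * ev d) -> ev a = 0 ->
  ev (b * a - q *: (a * b)) = 0.
Proof.
move=> evZ ev0.
by rewrite rmorphB evZ !rmorphM ev0 mulr0 mul0r mulr0 subr0.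
Qed.

Variables (V : lmodType F) (act : A -> V -> V).
Hypothesis actB : forall a b v, act (a - b) v = act a v - act b v.
Hypothesis actZl : forall c a v, act (c *: a) v = c *: act a v.
Hypothesis actZr : forall c a v, act a (c *: v) = c *: act a v.

Lemma act_scaleM c d a b v :
  (forall e a' b', e *: (a' * b') = a' * (e *: b') :> A) ->
  act (a * b) v = act a (act b v) ->
  act ((c *: a) * (d *: b)) v = act (c *: a) (act (d *: b) v).
Proof. by move=> Ar E; rewrite -scalerAl -Ar !actZl actZr E. Qed.

Lemma act_rel (q : F) a b v :
  (forall a' b' u, act (a' * b') u = act a' (act b' u)) ->
  act (b * a - q *: (a * b)) v = act b (act a v) - q *: act a (act b v).
Proof. by move=> actM; rewrite actB actZl !actM. Qed.

End AbstractAlgebra.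

Definition qplane (F : fieldType) (q : F) : Type := rquot (qrel q).

HB.instance Definition _ (F : fieldType) (q : F) := GRing.PzRing.on (qplane q).

Section QuantumPlane.
Variables (F : fieldType) (q : F).
Implicit Types (a b : free_alg F) (c : F).

Definition qpi a : qplane q := rquot_pi (qrel q) a.
Definition qlift (u : qplane q) : free_alg F := rquot_repr u.
Definition qX : qplane q := qpi (@freeX F).
Definition qY : qplane q := qpi (@freeY F).

Lemma qpiP a b : reflect (qpi a = qpi b) (a - b \in ideal2 (qrel q)).
Proof. exact: rquot_piP. Qed.

Lemma qliftK : cancel qlift qpi. Proof. exact: rquot_reprK. Qed.

Lemma qpiD : {morph qpi : a b / a + b}. Proof. exact: rquot_piD. Qed.
Lemma qpiM : {morph qpi : a b / a * b}. Proof. exact: rquot_piM. Qed.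
Lemma qpi1 : qpi 1 = 1. Proof. by []. Qed.

(* Elements of the defining ideal have no constant term. *)
Fact qplane_oner_neq0 : 1 != 0 :> qplane q.
Proof.
pose ev : {rmorphism free_alg F -> F} := mcoeff (mone : {fmonom bool}).
have evX : ev (freeX F) = 0.
  by rewrite /= /freeX mcoeffU fmP fm1 fmU.
have ev_rel : ev (qrel q) = 0.
  by apply: rel_kernel evX => c a; exact: mcoeffZ.
apply/eqP => h; have /qpiP : qpi 1 = qpi 0 by rewrite qpi1 h [RHS]rquot_pi0.
rewrite subr0 => /(ideal2_kernel ev_rel)/eqP.
by rewrite rmorph1 oner_eq0.
Qed.

HB.instance Definition _ :=
  GRing.PzSemiRing_isNonZero.Build (qplane q) qplane_oner_neq0.

Definition qplane_scale : F -> qplane q -> qplane q :=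
  locked (fun c u => qpi (c *: qlift u)).

Lemma qplane_scaleE c a : qplane_scale c (qpi a) = qpi (c *: a).
Proof.
rewrite /qplane_scale -lock; apply/qpiP; rewrite -scalerBr -mulr_algl ideal2Ml //.
by apply/qpiP; rewrite qliftK.
Qed.

Fact qplane_scalerA c d u :
  qplane_scale c (qplane_scale d u) = qplane_scale (c * d) u.
Proof. by rewrite -[u]qliftK !qplane_scaleE scalerA. Qed.

Fact qplane_scale1r : left_id 1 qplane_scale.
Proof. by move=> u; rewrite -[u]qliftK qplane_scaleE scale1r. Qed.

Fact qplane_scalerDr : right_distributive qplane_scale +%R.
Proof.
move=> c u v; rewrite -[u]qliftK -[v]qliftK.
by rewrite -qpiD !qplane_scaleE scalerDr qpiD.
Qed.

Fact qplane_scalerDl u : {morph qplane_scale^~ u : c d / c + d}.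
Proof. by move=> c d; rewrite -[u]qliftK !qplane_scaleE scalerDl qpiD. Qed.

HB.instance Definition _ := GRing.Zmodule_isLmodule.Build F (qplane q)
  qplane_scalerA qplane_scale1r qplane_scalerDr qplane_scalerDl.

Lemma qpiZ c a : qpi (c *: a) = c *: qpi a.
Proof. by rewrite -qplane_scaleE. Qed.

Fact qplane_scalerAl c (u v : qplane q) : c *: (u * v) = (c *: u) * v.
Proof.
by rewrite -[u]qliftK -[v]qliftK -qpiM -!qpiZ -qpiM scalerAl.
Qed.

HB.instance Definition _ :=
  GRing.Lmodule_isLalgebra.Build F (qplane q) qplane_scalerAl.

Fact qplane_scalerAr c (u v : qplane q) : c *: (u * v) = u * (c *: v).
Proof.
by rewrite -[u]qliftK -[v]qliftK -qpiM -!qpiZ -qpiM free_scalerAr.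
Qed.

HB.instance Definition _ :=
  GRing.Lalgebra_isAlgebra.Build F (qplane q) qplane_scalerAr.

Lemma qplane_rel : qY * qX = q *: (qX * qY).
Proof. by rewrite -!qpiM -qpiZ; apply/qpiP; exact: ideal2_gen. Qed.

End QuantumPlane.

Arguments qX {F}.
Arguments qY {F}.

(* The linear map sending the basis vector k of the free module {malg F[K]}
   to g k. *)
Section LinearExtension.
Variables (F : fieldType) (K : choiceType) (V : lmodType F) (g : K -> V).

Definition lin_ext (a : {malg F[K]}) : V := \sum_(k <- msupp a) a@_k *: g k.

Lemma lin_extEw (d : {fset K}) a :
  fsubset (msupp a) d -> lin_ext a = \sum_(k <- d) a@_k *: g k.
Proof.
move=> le; apply: big_fset_incl => // k _ /mcoeff_outdom ->.
by rewrite scale0r.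
Qed.

Fact lin_ext_linear : linear lin_ext.
Proof.
move=> c a b; pose d := (msupp a `|` msupp b `|` msupp (c *: a + b))%fset.
rewrite !(@lin_extEw d) ?fsubsetUr // /d.
- rewrite scaler_sumr -big_split; apply: eq_bigr => k _ /=.
  by rewrite mcoeffD mcoeffZ scalerDl scalerA.
- by apply: fsubset_trans (fsubsetUl _ _); apply: fsubsetUr.
- by apply: fsubset_trans (fsubsetUl _ _); apply: fsubsetUl.
Qed.

HB.instance Definition _ :=
  GRing.isLinear.Build F {malg F[K]} V _ lin_ext lin_ext_linear.

Lemma lin_extU k : lin_ext << k >> = g k.
Proof. by rewrite (lin_extEw msuppU_le) big_seq_fset1 mcoeffUU scale1r. Qed.

End LinearExtension.

Lemma malg_linear_ext (F : fieldType) (K : choiceType) (V : lmodType F)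
    (phi psi : {linear {malg F[K]} -> V}) :
  (forall k, phi << k >> = psi << k >>) -> phi =1 psi.
Proof.
move=> h a; rewrite [a]monalgE !linear_sum; apply: eq_bigr => k _.
have -> : << a@_k *g k >> = a@_k *: << k >> :> {malg F[K]}.
  by apply/malgP => l; rewrite [RHS]mcoeffZ [LHS]mcoeffU mcoeffU mulrnAr mulr1.
by rewrite !linearZ h.
Qed.

(* Only the vector space structure of F[t, t^-1] matters: it is the space
   with basis << i >> = t^i, i an integer. *)
Definition laurent (F : fieldType) : Type := {malg F[int]}.

HB.instance Definition _ (F : fieldType) := GRing.Lmodule.on (laurent F).

Section Operators.
Variables (F : fieldType) (m n : nat) (f : int -> F).

Definition tpow (i : int) : laurent F := << i >>.

Definition xop : laurent F -> laurent F := lin_ext (fun i => tpow (i + n%:Z)).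
Definition yop : laurent F -> laurent F :=
  lin_ext (fun i => f i *: tpow (i - m%:Z)).

HB.instance Definition _ := GRing.Linear.on xop.
HB.instance Definition _ := GRing.Linear.on yop.

Definition word_act (w : {fmonom bool}) (v : laurent F) : laurent F :=
  foldr (fun b => if b then yop else xop) v w.

Fact word_act_linear w : linear (word_act w).
Proof.
case: w => w c u v; rewrite /word_act /=.
by elim: w => //= b w ->; case: b; rewrite linearP.
Qed.

HB.instance Definition _ w :=
  GRing.isLinear.Build F (laurent F) (laurent F) _ (word_act w)
    (word_act_linear w).

Definition free_act (a : free_alg F) (v : laurent F) : laurent F :=
  lin_ext (word_act^~ v) a.

End Operators.

(* V^{m,n}_f; the parameters m, n, f do not change the underlying space, but
   they select the module structure declared below. *)
Definition qrep (F : fieldType) (q : F) (m n : nat) (f : int -> F)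
  (hf : forall i, f (i + n%:Z) = q * f i) : Type := laurent F.

Arguments qrep {F q} m n f hf.

Section Representation.
Variables (F : fieldType) (q : F) (m n : nat) (f : int -> F).
Hypothesis hf : forall i, f (i + n%:Z) = q * f i.
Local Notation act := (free_act m n f).
Implicit Types (a b : free_alg F) (u v : laurent F).

Lemma free_actDl a b v : act (a + b) v = act a v + act b v.
Proof. exact: (linearD (lin_ext (word_act m n f ^~ v))). Qed.

Lemma free_actBl a b v : act (a - b) v = act a v - act b v.
Proof. exact: (linearB (lin_ext (word_act m n f ^~ v))). Qed.

Lemma free_actZl c a v : act (c *: a) v = c *: act a v.
Proof. exact: (linearZ_LR (lin_ext (word_act m n f ^~ v))). Qed.

Lemma free_actP a c u v : act a (c *: u + v) = c *: act a u + act a v.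
Proof.
rewrite /free_act /lin_ext scaler_sumr -big_split; apply: eq_bigr => w _ /=.
by rewrite word_act_linear scalerDr !scalerA mulrC.
Qed.

Lemma free_actDr a u v : act a (u + v) = act a u + act a v.
Proof. by have := free_actP a 1 u v; rewrite !scale1r. Qed.

Lemma free_act0r a : act a 0 = 0.
Proof. by apply: (addIr (act a 0)); rewrite -free_actDr !add0r. Qed.

Lemma free_actZr a c u : act a (c *: u) = c *: act a u.
Proof. by have := free_actP a c u 0; rewrite free_act0r !addr0. Qed.

Lemma free_actU w v : act << w >> v = word_act m n f w v.
Proof. exact: lin_extU. Qed.

Lemma free_act1 v : act 1 v = v.
Proof. by rewrite free_actU /word_act fm1. Qed.

Lemma free_actM a b v : act (a * b) v = act a (act b v).
Proof.
have sumM (g : free_alg F) :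
    g = \sum_(w <- msupp g) g@_w *: (<< w >> : free_alg F).
  rewrite {1}[g]monalgE; apply: eq_bigr => w _.
  by apply/malgP => l; rewrite [RHS]mcoeffZ [LHS]mcoeffU mcoeffU mulrnAr mulr1.
have act_suml (s : seq {fmonom bool}) (G : {fmonom bool} -> free_alg F) u :
    act (\sum_(w <- s) G w) u = \sum_(w <- s) act (G w) u.
  exact: (linear_sum (lin_ext (word_act m n f ^~ u))).
have act_sumr (s : seq {fmonom bool}) (G : {fmonom bool} -> laurent F) c :
    act c (\sum_(w <- s) G w) = \sum_(w <- s) act c (G w).
  elim: s => [|w s IH]; first by rewrite !big_nil free_act0r.
  by rewrite !big_cons free_actDr IH.
rewrite [a]sumM [b]sumM mulr_suml !act_suml; apply: eq_bigr => w _.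
rewrite mulr_sumr act_sumr act_suml; apply: eq_bigr => w' _.
apply: (act_scaleM free_actZl) => [c a' u|e a' b'|].
- exact: free_actZr.
- exact: free_scalerAr.
have -> : (<< w >> : free_alg F) * << w' >> = << mmul w w' >>.
  by rewrite malgM_def fgmulUU mulr1.
by rewrite !free_actU /word_act fmM foldr_cat.
Qed.

Lemma xopE i : xop n (tpow F i) = tpow F (i + n%:Z).
Proof. exact: lin_extU. Qed.

Lemma yopE i : yop m f (tpow F i) = f i *: tpow F (i - m%:Z).
Proof. exact: lin_extU. Qed.

Lemma free_actX v : act (freeX F) v = xop n v.
Proof. by rewrite free_actU /word_act fmU. Qed.

Lemma free_actY v : act (freeY F) v = yop m f v.
Proof. by rewrite free_actU /word_act fmU. Qed.

Lemma xyop_rel v : yop m f (xop n v) = q *: xop n (yop m f v).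
Proof.
pose phi : {linear laurent F -> laurent F} := yop m f \o xop n.
pose psi : {linear laurent F -> laurent F} := q \*: (xop n \o yop m f).
apply: (@malg_linear_ext F int (laurent F) phi psi) => i /=.
rewrite -/(tpow F i) xopE !yopE linearZ /= xopE hf scalerA.
by rewrite addrAC.
Qed.

Lemma free_act_qrel v : act (qrel q) v = 0.
Proof.
rewrite [LHS](act_rel free_actBl free_actZl _ _ _ _ free_actM).
by rewrite !free_actX !free_actY xyop_rel subrr.
Qed.

Lemma free_act_rel a v : a \in ideal2 (qrel q) -> act a v = 0.
Proof.
move=> /asboolP[s ->]; elim: s => [|p s IH].
  by rewrite big_nil -[0](subrr 0) free_actBl subrr.
rewrite big_cons free_actDl {}IH addr0.
by rewrite (free_actM (p.1 * _)) (free_actM p.1) free_act_qrel free_act0r.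
Qed.

Definition qrep_scale : qplane q -> laurent F -> laurent F :=
  locked (fun r v => act (qlift r) v).

Lemma qrep_scaleE a v : qrep_scale (qpi q a) v = act a v.
Proof.
rewrite /qrep_scale -lock; apply/eqP; rewrite -subr_eq0 -free_actBl; apply/eqP/free_act_rel.
by apply/qpiP; rewrite qliftK.
Qed.

Fact qrep_scalerA r s v :
  qrep_scale r (qrep_scale s v) = qrep_scale (r * s) v.
Proof. by rewrite -[r]qliftK -[s]qliftK -qpiM !qrep_scaleE free_actM. Qed.

Fact qrep_scale1r : left_id 1 qrep_scale.
Proof. by move=> v; rewrite -qpi1 qrep_scaleE free_act1. Qed.

Fact qrep_scalerDr : right_distributive qrep_scale +%R.
Proof. by move=> r u v; rewrite -[r]qliftK !qrep_scaleE free_actDr. Qed.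

Fact qrep_scalerDl v : {morph qrep_scale^~ v : r s / r + s}.
Proof.
by move=> r s; rewrite -[r]qliftK -[s]qliftK -qpiD !qrep_scaleE free_actDl.
Qed.

HB.instance Definition _ := GRing.Zmodule.on (qrep m n f hf).
HB.instance Definition _ := GRing.Zmodule_isLmodule.Build (qplane q) (qrep m n f hf)
  qrep_scalerA qrep_scale1r qrep_scalerDr qrep_scalerDl.

Definition qrep_t (i : int) : qrep m n f hf := tpow F i.

Lemma qrepX i : qX q *: qrep_t i = qrep_t (i + n%:Z).
Proof. by rewrite /GRing.scale /= qrep_scaleE free_actX xopE. Qed.

Lemma qrepY i : qY q *: qrep_t i = f i *: tpow F (i - m%:Z) :> laurent F.
Proof. by rewrite /GRing.scale /= qrep_scaleE free_actY yopE. Qed.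

Lemma qrepC c (v : laurent F) : (c%:A : qplane q) *: (v : qrep m n f hf) = c *: v.
Proof.
rewrite -qpi1 -qpiZ [LHS]qrep_scaleE free_actZl.
by rewrite free_act1.
Qed.

End Representation.

Arguments qrep_t {F q} m n f hf i.

Definition sconst (F : fieldType) (m n : nat) (f : int -> F) : F :=
  \prod_(i < n) f (- (i%:Z * m%:Z)).

(* Main.v *)
From HB Require Import structures.
Require Import Defs.
From mathcomp Require Import all_boot all_order all_algebra.
From mathcomp Require Import finmap monalg zify ring boolp.
Import GRing.Theory.

Set Implicit Arguments.
Unset Strict Implicit.
Unset Printing Implicit Defensive.

Local Open Scope ring_scope.

(** A monomial x^a y^b sends t^j to a nonzero multiple of t^(j + an - bm).
Divide it by that multiple.  Since m and n are coprime, every exponent i is of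
the form j + an - bm with a, b natural numbers, and two pairs with the same
value of j + an - bm differ by a multiple of (m, n).  On the other hand x^m y^n
multiplies t^j by s(j) = f(j) f(j - m) ... f(j - (n-1)m), which is nonzero.
Hence in any left module M with a vector e killed by x^m y^n - s(j), the
normalized monomials of (a, b) and (a + m, b + n) act alike on e
([nmonom_step]), and a normalized monomial acts on e in a way that depends only
on the exponent it reaches ([nmonom_weight]).

Choosing one normalized monomial for each exponent i gives a linear map Phi from
Laurent polynomials to the quantum plane such that Phi(v).t^j = v, and such that
Phi(r.t^j).e = r.e for all r and all e as above ([tpow_section]).  Everything in
(a) and the construction of isomorphisms in (b) follow from it.  With e the
class of 1 modulo x^m y^n - s(j), it shows that an element r killing t^j
satisfies r.e = 0, so the annihilator of t^j is generated by x^m y^n - s(j)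
([annihilator_tpow]); and V is isomorphic to any module generated by a vector
with that annihilator ([cyclic_iso]).  Such a vector is 1 in the quotient, and
it is t^(-k) in V' when (m', n') = (m, n) and s' = q^k s, because
s'(-k) = q^(-k) s'(0).

Conversely, let V and V' be isomorphic and consider w = x^m y^n.  On V it is
diagonal in the basis t^i with eigenvalues s(i) = q^i s(0), pairwise distinct as
q is not a root of unity, so its eigenspaces are lines.  On V' it shifts
exponents by mn' - nm', and a nonzero shift would not have an eigenvector, a
Laurent polynomial having finite support ([eigen_shift_eq0]).  Hence m' = dm and
n' = dn for some d, and w is diagonal on V' with eigenvalues g(i) such that
g(i + d) = q g(i).  The numbers g(0) and g(1) are both eigenvalues of w on V, so
g(1) = q^k g(0) = g(kd) for some k.  The eigenspaces of w being lines, kd = 1.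
So d = 1, and s' = g(0) is a value s(a) = q^a s(0). *)

(** * Linear induction on free modules *)

Lemma malg_span_ind (F : fieldType) (K : choiceType) (P : {malg F[K]} -> Prop) :
  P 0 -> (forall c u v, P u -> P v -> P (c *: u + v)) ->
  (forall k, P << k >>) -> forall u, P u.
Proof.
move=> P0 PD PU u; rewrite [u]monalgE.
elim: (enum_fset _) => [|k s IH]; first by rewrite big_nil.
rewrite big_cons.
have -> : << u@_k *g k >> = u@_k *: << k >> :> {malg F[K]}.
  by apply/malgP => l; rewrite [RHS]mcoeffZ [LHS]mcoeffU mcoeffU mulrnAr mulr1.
exact: PD.
Qed.

(** * Products of f along an arithmetic progression *)

Section FallingProduct.
Variables (F : fieldType) (f : int -> F).

(** With M = m and N = n this is the scalar by which x^m y^n acts on t^i; for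
    other N it is the coefficient produced by y^N. *)
Definition step_prod (M N : nat) (i : int) : F :=
  \prod_(l < N) f (i - (l * M)%N%:Z).

Lemma sconstE M N : sconst M N f = step_prod M N 0.
Proof. by apply: eq_bigr => l _; rewrite sub0r PoszM. Qed.

Lemma step_prod_neq0 M N i : (forall i, f i != 0) -> step_prod M N i != 0.
Proof. by move=> f0; apply/prodf_neq0 => l _. Qed.

Lemma step_prodS M N i :
  step_prod M N.+1 i = step_prod M N i * f (i - (N * M)%N%:Z).
Proof. exact: big_ord_recr. Qed.

Lemma step_prodSl M N i :
  step_prod M N.+1 i = f i * step_prod M N (i - M%:Z).
Proof.
rewrite /step_prod big_ord_recl mul0n subr0; congr (_ * _).
by apply: eq_bigr => l _; congr f; rewrite lift0 mulSn PoszD opprD addrA.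
Qed.

Lemma step_prodD M N N' i :
  step_prod M (N + N') i = step_prod M N i * step_prod M N' (i - (N * M)%N%:Z).
Proof.
rewrite /step_prod big_split_ord /=; congr (_ * _).
by apply: eq_bigr => l _; congr f; lia.
Qed.
End FallingProduct.

Lemma bezout_coprime (m n : nat) : gcdn m n = 1%N ->
  exists u v : int, u * m%:Z + v * n%:Z = 1.
Proof.
move=> cmn; have [u [v uv]] := Bezoutz m n.
by exists u, v; rewrite uv /gcdz /= cmn.
Qed.

Lemma quasi_shift (F : fieldType) (A : int -> F) (e : int) (c : F) :
  c != 0 -> (forall i, A (i + e) = c * A i) ->
  forall (k : int) i, A (i + k * e) = c ^ k * A i.
Proof.
move=> c0 hA.
have pos (k : nat) i : A (i + k%:Z * e) = c ^ k%:Z * A i.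
  elim: k i => [|k IH] i; first by rewrite mul0r addr0 expr0z mul1r.
  have -> : i + k.+1%:Z * e = (i + k%:Z * e) + e by lia.
  by rewrite hA IH mulrA -exprS.
case=> k i; first exact: pos.
rewrite NegzE; set k1 := k.+1.
have -> : A i = c ^ k1%:Z * A (i + - k1%:Z * e) by rewrite -pos; congr A; lia.
by rewrite mulrA -expfzDr // addNr expr0z mul1r.
Qed.

Section Quasiperiodic.
Variables (F : fieldType) (q : F) (m n d : nat) (f : int -> F).
Hypothesis q0 : q != 0.
Hypothesis f0 : forall i, f i != 0.
Hypothesis cmn : gcdn m n = 1%N.
Hypothesis hf : forall i, f (i + (d * n)%N%:Z) = q * f i.

(** Shifting i by dm drops the last factor of the product and adds a new first
    one; their arguments are m periods dn apart, so their ratio is q^m.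
    Shifting i by dn multiplies each of the n factors by q.  Bezout combines
    both shifts into the shift by d.  The case d > 1 serves to compare two
    representations whose parameters are proportional. *)
Lemma step_prod_quasi (k i : int) :
  step_prod f (d * m) n (i + k * d%:Z) = q ^ k * step_prod f (d * m) n i.
Proof.
pose S := step_prod f (d * m) n; rewrite -/(S _) -/(S i).
have hfk := quasi_shift q0 hf.
have Sm j : S (j + (d * m)%N%:Z) = q ^ m%:Z * S j.
  apply: (mulIf (f0 (j + (d * m)%N%:Z - (n * (d * m))%N%:Z))).
  rewrite -step_prodS step_prodSl addrK mulrAC -/(S j); congr (_ * _).
  by rewrite -hfk; congr f; lia.
have Sn j : S (j + (d * n)%N%:Z) = q ^ n%:Z * S j.
  have -> : q ^ n%:Z = \prod_(l < n) q by rewrite prodr_const card_ord.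
  rewrite /S /step_prod -big_split /=.
  by apply: eq_bigr => l _; rewrite -hf; congr f; lia.
have qz (e : int) : q ^ e != 0 by rewrite expfz_neq0.
have [u [v uv]] := bezout_coprime cmn.
have -> : i + k * d%:Z = i + (k * u) * (d * m)%N%:Z + (k * v) * (d * n)%N%:Z.
  by rewrite -[k in LHS]mulr1 -uv !PoszM; ring.
rewrite (quasi_shift (qz _) Sn) (quasi_shift (qz _) Sm) mulrA.
rewrite !exprz_exp -expfzDr //; congr (q ^ _ * _).
by rewrite -[RHS]mulr1 -uv; ring.
Qed.
End Quasiperiodic.

(** * Monomials of the quantum plane *)

Section QPlane.
Variables (F : fieldType) (q : F).

Lemma qplane_scaler (M : lmodType (qplane q)) (c : F) (r : qplane q) (e : M) :
  (c *: r) *: e = c%:A *: (r *: e).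
Proof. by rewrite scalerA mulr_algl. Qed.

Lemma qplane_algC (M : lmodType (qplane q)) (c : F) (r : qplane q) (e : M) :
  r *: (c%:A *: e) = c%:A *: (r *: e).
Proof. by rewrite !scalerA mulr_algl mulr_algr. Qed.

Lemma qplane_algA (M : lmodType (qplane q)) (c d : F) (e : M) :
  (c%:A : qplane q) *: ((d%:A : qplane q) *: e) = (c * d)%:A *: e.
Proof. by rewrite scalerA mulr_algl scalerA. Qed.

Definition monom (a b : nat) : qplane q := qX q ^+ a * qY q ^+ b.

Lemma qY_qXn a : qY q * qX q ^+ a = q ^+ a *: (qX q ^+ a * qY q).
Proof.
elim: a => [|a IH]; first by rewrite !expr0 mulr1 mul1r scale1r.
rewrite !exprS mulrA qplane_rel -scalerAl -(mulrA (qX q) (qY q)) IH -scalerAr.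
by rewrite scalerA mulrA.
Qed.

Lemma qYn_qXn a b :
  qY q ^+ b * qX q ^+ a = q ^+ (a * b) *: (qX q ^+ a * qY q ^+ b).
Proof.
elim: b => [|b IH]; first by rewrite !expr0 muln0 expr0 mulr1 mul1r scale1r.
rewrite !exprS -(mulrA (qY q)) IH -scalerAr (mulrA (qY q)) qY_qXn -scalerAl.
by rewrite scalerA -(mulrA _ (qY q)) -exprD mulnS addnC.
Qed.

(** The monomials x^a y^b span: moving each letter y to the right past the
    powers of x turns a word into a multiple of a monomial. *)
Lemma qplane_monom_ind (P : qplane q -> Prop) :
  (forall c r s, P r -> P s -> P (c *: r + s)) ->
  (forall a b, P (monom a b)) -> forall r, P r.
Proof.
move=> PD PM r; rewrite -[r]qliftK.
have P0 : P 0 by rewrite -[0](addNr (monom 0 0)) -scaleN1r; apply: PD.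
apply: (@malg_span_ind F _ (fun a => P (qpi q a))) => [|c u v ? ?|w].
- by rewrite [qpi q 0]rquot_pi0.
- by rewrite qpiD qpiZ; apply: PD.
- suff [c [a [b ->]]] : exists c a b, qpi q << w >> = c *: monom a b.
    by rewrite -[_ *: _]addr0; apply: PD.
  case: w => w; elim: w => [|l w [c [a [b IH]]]].
    exists 1, 0%N, 0%N; rewrite scale1r /monom mulr1 expr0 -qpi1.
    have -> : FMonom [::] = mone :> {fmonom bool} by apply/eqP; rewrite fmP fm1.
    by [].
  have -> : qpi q << FMonom (l :: w) >> =
            (if l then qY q else qX q) * (c *: monom a b).
    rewrite -IH /qY /qX -(fun_if (qpi q)) -qpiM; congr qpi.
    have -> : FMonom (l :: w) = mmul (fmu l) (FMonom w).
      by apply/eqP; rewrite fmP fmM fmU.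
    by case: (l); rewrite [RHS]malgM_def fgmulUU mulr1.
  case: l; rewrite -scalerAr.
    exists (c * q ^+ a), a, b.+1.
    by rewrite /monom mulrA qY_qXn -scalerAl scalerA -(mulrA _ (qY q)) -exprS.
  by exists c, a.+1, b; rewrite /monom mulrA -exprS.
Qed.

End QPlane.

(** * Action of the monomials on Laurent polynomials *)

Section Rep.
Variables (F : fieldType) (q : F) (m n : nat) (f : int -> F).
Hypothesis hf : forall i, f (i + n%:Z) = q * f i.
Local Notation V := (qrep m n f hf).
Local Notation t := (qrep_t m n f hf).

Lemma qY_tpow i : qY q *: t i = (f i)%:A *: t (i - m%:Z).
Proof. by rewrite qrepC -qrepY. Qed.

Lemma qXn_tpow a i : qX q ^+ a *: t i = t (i + (a * n)%N%:Z).
Proof.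
elim: a => [|a IH]; first by rewrite expr0 scale1r addr0.
by rewrite exprS -scalerA IH qrepX; congr t; lia.
Qed.

Lemma qYn_tpow b i :
  qY q ^+ b *: t i = (step_prod f m b i)%:A *: t (i - (b * m)%N%:Z).
Proof.
elim: b => [|b IH].
  by rewrite expr0 /step_prod big_ord0 !scale1r subr0.
rewrite exprS -scalerA IH qplane_algC qY_tpow qplane_algA -step_prodS.
by congr (_ *: t _); lia.
Qed.

Lemma monom_tpow a b i : monom q a b *: t i =
  (step_prod f m b i)%:A *: t (i - (b * m)%N%:Z + (a * n)%N%:Z).
Proof. by rewrite /monom -scalerA qYn_tpow qplane_algC qXn_tpow. Qed.

(** Shifting exponents is injective, so that t^i alone contributes to the
    coefficient at i + e. *)
Lemma mcoeff_shift (r : qplane q) (g : int -> F) (e : int) :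
  (forall i, r *: t i = (g i)%:A *: t (i + e)) ->
  forall (v : V) i, (r *: v : laurent F)@_(i + e) = g i * (v : laurent F)@_i.
Proof.
move=> hr; apply: malg_span_ind => [i|c u v hu hv i|k i].
- have -> : r *: (0 : V) = 0 by rewrite scaler0.
  by rewrite [X in X@_(i + e)](_ : _ = 0 :> laurent F) // !mcoeff0 mulr0.
- have -> : r *: ((c *: u + v : laurent F) : V) =
            (c *: (r *: (u : V) : laurent F) + (r *: (v : V) : laurent F)).
    transitivity (r *: ((c%:A : qplane q) *: (u : V) + (v : V))).
      by rewrite qrepC.
    by rewrite [LHS]scalerDr qplane_algC qrepC.
  by rewrite !mcoeffD !mcoeffZ hu hv mulrDr mulrCA.
have -> : r *: (<< k >> : V) = r *: t k by [].
rewrite hr qrepC mcoeffZ !mcoeffU (inj_eq (addIr e)).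
by case: eqP => [->|_]; rewrite ?mulr0n ?mulr0.
Qed.

Lemma qrep_span_ind (P : V -> Prop) :
  P 0 -> (forall (c : F) u v, P u -> P v -> P ((c%:A : qplane q) *: u + v)) ->
  (forall i, P (t i)) -> forall v, P v.
Proof.
move=> P0 PD Pt v; apply: (@malg_span_ind F _ P) => // c u w hu hw.
by have := PD c _ _ hu hw; rewrite qrepC.
Qed.

End Rep.

(** * Linear section of the orbit map *)

Lemma rep_iso_intro (R : pzRingType) (V W : lmodType R) (phi : V -> W) :
  linear phi -> bijective phi -> rep_iso V W.
Proof.
move=> lin bij.
pose phiL : {linear V -> W} := HB.pack phi (GRing.isLinear.Build R V W _ phi lin).
by exists phiL.
Qed.

Section Cyclic.
Variables (F : fieldType) (q : F) (m n : nat) (f : int -> F).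
Hypothesis q0 : q != 0.
Hypothesis m_gt0 : (0 < m)%N.
Hypothesis n_gt0 : (0 < n)%N.
Hypothesis cmn : gcdn m n = 1%N.
Hypothesis f0 : forall i, f i != 0.
Hypothesis hf : forall i, f (i + n%:Z) = q * f i.
Variable j : int.
Local Notation V := (qrep m n f hf).
Local Notation t := (qrep_t m n f hf).

Lemma step_prod_shift i k :
  step_prod f m n (i + k) = q ^ k * step_prod f m n i.
Proof.
have hf1 i' : f (i' + (1 * n)%N%:Z) = q * f i' by rewrite mul1n.
by have := step_prod_quasi q0 f0 cmn hf1 k i; rewrite mul1n mulr1.
Qed.

(** Normalized so that t^j is sent to a power of t, with coefficient 1. *)
Definition nmonom a b : qplane q := (step_prod f m b j)^-1 *: monom q a b.

Lemma nmonom_tpow a b : nmonom a b *: t j = t (j - (b * m)%N%:Z + (a * n)%N%:Z).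
Proof.
by rewrite qplane_scaler monom_tpow qplane_algA mulVf ?scale1r // step_prod_neq0.
Qed.

Definition eigen_gen (c : F) : qplane q := qX q ^+ m * qY q ^+ n - c%:A.

Lemma eigen_genP (M : lmodType (qplane q)) (c : F) (e : M) :
  eigen_gen c *: e = 0 <-> monom q m n *: e = c%:A *: e.
Proof.
rewrite /eigen_gen -/(monom q m n) scalerBl.
by split=> [/eqP|->]; [rewrite subr_eq0 => /eqP | rewrite subrr].
Qed.

Section Target.
Variables (M : lmodType (qplane q)) (e : M).
Hypothesis he : eigen_gen (step_prod f m n j) *: e = 0.

(** Up to a power of q, x^(a+m) y^(b+n) is x^a y^b x^m y^n, and x^m y^n acts on
    e as the scalar s(j).  On the other side the normalizing product for b + n
    has n more factors than that for b, whose product s(j - bm) is q^(-bm) s(j).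
    The powers of q cancel. *)
Lemma nmonom_step a b : nmonom (a + m) (b + n) *: e = nmonom a b *: e.
Proof.
rewrite /nmonom.
have qmb : q ^+ (m * b) != 0 by rewrite expf_neq0.
have -> : monom q (a + m) (b + n) =
          (q ^+ (m * b))^-1 *: (monom q a b * monom q m n) :> qplane q.
  rewrite /monom -mulrA (mulrA (_ ^+ b)) qYn_qXn -scalerAl -scalerAr scalerA.
  by rewrite mulVf // scale1r -mulrA -exprD mulrA -exprD.
have ub := step_prod_neq0 m b j f0.
have S0 := step_prod_neq0 m n (j - (b * m)%N%:Z) f0.
have eS : step_prod f m n j = q ^+ (m * b) * step_prod f m n (j - (b * m)%N%:Z).
  by rewrite exprnP -step_prod_shift; congr step_prod; lia.
have hw := (eigen_genP _ _).1 he.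
(* The instances are explicit: c%:A is itself of the form c *: r, so that the
   rule applies to its own result. *)
set ab := monom q a b; set mn := monom q m n.
rewrite (qplane_scaler _ (_ *: (ab * mn))) (qplane_scaler _ (ab * mn)).
rewrite (qplane_scaler _ ab) -(scalerA ab) hw (qplane_algC _ ab) !qplane_algA.
by congr (_%:A *: _); rewrite step_prodD eS; field; rewrite S0 ub qmb.
Qed.

(** By coprimality, two monomials that send t^j to the same line differ by a
    multiple of (m, n) in their exponents, hence by finitely many steps. *)
Lemma nmonom_weight a b a' b' :
  j - (b * m)%N%:Z + (a * n)%N%:Z = j - (b' * m)%N%:Z + (a' * n)%N%:Z ->
  nmonom a b *: e = nmonom a' b' *: e.
Proof.
wlog le_b : a b a' b' / (b <= b')%N.
  by move=> H E; have [le_b|/ltnW le_b] := leqP b b'; [|symmetry]; apply: H.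
move=> E; have {}E : ((b' - b) * m = (a' - a) * n)%N /\ (a <= a')%N by nia.
have [k def_k] : exists k, b' = (b + k * n)%N.
  have: (n %| (b' - b) * m)%N by rewrite E.1 dvdn_mull.
  rewrite Gauss_dvdl /coprime 1?gcdnC ?cmn // => /dvdnP[k hk].
  by exists k; rewrite -hk subnKC.
have -> : a' = (a + k * m)%N by nia.
rewrite {}def_k {E le_b}.
elim: k => [|k IH]; first by rewrite !mul0n !addn0.
by rewrite !mulSnr !addnA nmonom_step.
Qed.
End Target.

Lemma weight_ex i :
  exists ab : nat * nat, j - (ab.2 * m)%N%:Z + (ab.1 * n)%N%:Z = i.
Proof.
have [u [v uv]] := bezout_coprime cmn.
(* The Bezout pair (k v, - k u) reaches i but may have negative entries; adding
   T times (m, n) makes both nonnegative without changing the exponent reached. *)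
pose k : int := i - j; pose T := (absz (k * u)%R + absz (k * v)%R)%N.
have ha : 0 <= k * v + (T * m)%N%:Z by nia.
have hb : 0 <= (T * n)%N%:Z - k * u by nia.
exists (absz (k * v + (T * m)%N%:Z)%R, absz ((T * n)%N%:Z - k * u)%R) => /=.
rewrite !PoszM !gez0_abs //.
have -> : i = j + k * (u * m%:Z + v * n%:Z) by rewrite uv mulr1 /k; ring.
by ring.
Qed.

(** The substitute for a normal form: Phi picks, linearly in v, an element that
    sends t^j to v, and this choice is compatible with every vector e satisfying
    the relation that t^j satisfies.  The second clause holds because it may be
    checked on monomials r, where it is [nmonom_weight]. *)
Lemma tpow_section : exists Phi : {linear laurent F -> qplane q},
  (forall v : V, Phi v *: t j = v) /\
  (forall (M : lmodType (qplane q)) (e : M),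
     eigen_gen (step_prod f m n j) *: e = 0 ->
   forall r, Phi (r *: t j) *: e = r *: e).
Proof.
pose w i := projT1 (cid (weight_ex i)).
have wP i : j - ((w i).2 * m)%N%:Z + ((w i).1 * n)%N%:Z = i.
  by rewrite /w; case: cid.
pose Phi : {linear laurent F -> qplane q} :=
  lin_ext (fun i => nmonom (w i).1 (w i).2).
have PhiE i : Phi (t i) = nmonom (w i).1 (w i).2 by exact: lin_extU.
have PhiD c (u v : V) : Phi ((c%:A : qplane q) *: u + v) = c *: Phi u + Phi v.
  by rewrite qrepC -linearP.
exists Phi; split.
  apply: qrep_span_ind => [|c u v hu hv|i].
  - by rewrite (_ : Phi 0 = 0) ?scale0r // linear0.
  - by rewrite PhiD scalerDl qplane_scaler hu hv.
  - by rewrite PhiE nmonom_tpow wP.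
move=> M e he.
apply: qplane_monom_ind => [c r s hr hs|a b].
  rewrite scalerDl (qplane_scaler c r (t j)) PhiD scalerDl (qplane_scaler c _ e) hr hs.
  by rewrite scalerDl (qplane_scaler c r e).
have := PhiD (step_prod f m b j) (t (j - (b * m)%N%:Z + (a * n)%N%:Z)) 0.
rewrite addr0 -monom_tpow => ->; rewrite (_ : Phi 0 = 0) ?addr0 ?linear0 //.
rewrite PhiE qplane_scaler (nmonom_weight he (wP _)) -qplane_scaler.
by rewrite /nmonom scalerA mulfV ?scale1r // step_prod_neq0.
Qed.

End Cyclic.

(** * The representation as a cyclic module *)

Section Quotient.
Variables (F : fieldType) (q : F) (m n : nat) (f : int -> F).
Hypothesis q0 : q != 0.
Hypothesis m_gt0 : (0 < m)%N.
Hypothesis n_gt0 : (0 < n)%N.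
Hypothesis cmn : gcdn m n = 1%N.
Hypothesis f0 : forall i, f i != 0.
Hypothesis hf : forall i, f (i + n%:Z) = q * f i.
Local Notation V := (qrep m n f hf).
Local Notation t := (qrep_t m n f hf).
Local Notation z j := (eigen_gen q m n (step_prod f m n j)).

(** The exponent i + 0 presents the diagonal action as a shift by 0, the form
    under which eigenvectors are studied below. *)
Lemma monom_diag i : monom q m n *: t i = (step_prod f m n i)%:A *: t (i + 0).
Proof. by rewrite monom_tpow mulnC subrK addr0. Qed.

Lemma eigen_gen_tpow j : z j *: t j = 0.
Proof. by apply/eigen_genP; rewrite monom_diag addr0. Qed.

Lemma lquot_gen_eq0 (r u : qplane q) :
  r *: lquot_pi (left_ideal u) (1 : (qplane q)^o) = 0 <-> r \in left_ideal u.
Proof.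
rewrite -lquot_piZ [r *: _]mulr1.
have -> : 0 = lquot_pi (left_ideal u) (0 : (qplane q)^o).
  by rewrite -(scale0r (0 : (qplane q)^o)) lquot_piZ scale0r.
split=> [/lquot_piP|h]; first by rewrite subr0.
by apply/lquot_piP; rewrite subr0.
Qed.

(** The class e of 1 modulo the left ideal satisfies Phi(r.t^j).e = r.e, so that
    r.t^j = 0 forces r into the ideal. *)
Lemma annihilator_tpow j : annihilator (t j) =i left_ideal (z j).
Proof.
have [Phi [PhiK PhiM]] := tpow_section q0 m_gt0 n_gt0 cmn f0 hf j.
move=> r; apply/idP/idP => [/eqP rt|].
  apply/lquot_gen_eq0; rewrite -PhiM; last first.
    by apply/lquot_gen_eq0/asboolP; exists 1; rewrite mul1r.
  by rewrite rt (_ : Phi 0 = 0) ?scale0r ?linear0.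
by move=> /asboolP[b ->]; apply/eqP; rewrite -scalerA eigen_gen_tpow scaler0.
Qed.

(** The isomorphism is v |-> Phi(v).e; its inverse sends r.e to r.t^j. *)
Lemma cyclic_iso j (M : lmodType (qplane q)) (e : M) :
  (forall x, exists r : qplane q, x = r *: e) ->
  (forall r : qplane q, r *: e = 0 <-> r \in left_ideal (z j)) ->
  rep_iso V M.
Proof.
move=> gen_e ann_e.
have [Phi [PhiK PhiM]] := tpow_section q0 m_gt0 n_gt0 cmn f0 hf j.
have ze : z j *: e = 0 by apply/ann_e/asboolP; exists 1; rewrite mul1r.
have PhiMe := PhiM M e ze.
apply: (@rep_iso_intro _ V M (fun v => Phi v *: e)).
  move=> r u v /=; rewrite -{1}(PhiK u) -{1}(PhiK v) scalerA -scalerDl PhiMe.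
  by rewrite scalerDl -scalerA.
pose psi (x : M) : V := projT1 (cid (gen_e x)) *: t j.
exists psi => [v|x]; rewrite /psi; case: cid => r /= hr; last by rewrite PhiMe.
rewrite -[RHS]PhiK; apply/eqP; rewrite -subr_eq0 -scalerBl; apply/eqP.
have /asboolP[b ->] : r - Phi v \in left_ideal (z j).
  by apply/ann_e; rewrite scalerBl hr subrr.
by rewrite -scalerA eigen_gen_tpow scaler0.
Qed.

Lemma tpow_gen j (v : V) : exists r : qplane q, v = r *: t j.
Proof.
have [Phi [PhiK _]] := tpow_section q0 m_gt0 n_gt0 cmn f0 hf j.
by exists (Phi v); rewrite PhiK.
Qed.

End Quotient.

(** * Eigenvectors of homogeneous elements *)

Section Spectrum.
Variables (F : fieldType) (q : F) (m n : nat) (f : int -> F).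
Hypothesis hf : forall i, f (i + n%:Z) = q * f i.
Local Notation V := (qrep m n f hf).
Local Notation t := (qrep_t m n f hf).

Lemma laurent_neq0 (v : V) : v != 0 -> exists i, (v : laurent F)@_i != 0.
Proof.
move=> v0; apply: contrapT => H; move/eqP: v0; apply.
apply/malgP => i; rewrite mcoeff0; apply/eqP/negPn/negP => vi.
by apply: H; exists i.
Qed.

Lemma tpow_neq0 i : t i != 0.
Proof.
apply/eqP => /(congr1 (fun v : V => (v : laurent F)@_i)) /eqP.
by rewrite mcoeffUU mcoeff0 oner_eq0.
Qed.

Lemma laurent_bounded (v : laurent F) :
  exists B : nat, forall i, v@_i != 0 -> (absz i <= B)%N.
Proof.
move: v; apply: malg_span_ind => [|c u v [B hB] [B' hB']|k].
- by exists 0%N => i; rewrite mcoeff0 eqxx.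
- exists (maxn B B') => i; rewrite mcoeffD mcoeffZ leq_max.
  have [->|/hB -> //] := eqVneq u@_i 0.
  by rewrite mulr0 add0r => /hB' ->; rewrite orbT.
- exists (absz k) => i; rewrite mcoeffU; case: (k =P i) => [->//|_].
  by rewrite eqxx.
Qed.

Variables (r : qplane q) (g : int -> F) (c : F) (v : V).
Hypothesis rv : r *: v = c%:A *: v.

(** If r shifts exponents by e, the support of an eigenvector is stable under
    the shift, and finite. *)
Lemma eigen_shift_eq0 e : (forall i, g i != 0) ->
  (forall i, r *: t i = (g i)%:A *: t (i + e)) -> v != 0 -> e = 0.
Proof.
move=> g0 hr /laurent_neq0[i vi]; apply/eqP/negPn/negP => e0.
have shift k : (v : laurent F)@_(i + k%:Z * e) != 0.
  elim: k => [|k IH]; first by rewrite mul0r addr0.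
  have -> : i + k.+1%:Z * e = (i + k%:Z * e) + e by lia.
  have := mcoeff_shift hr v (i + k%:Z * e); rewrite rv qrepC mcoeffZ => E.
  by apply: contraNneq (mulf_neq0 (g0 (i + k%:Z * e)) IH) => w0; rewrite -E w0 mulr0.
have [B hB] := laurent_bounded v.
have := hB _ (shift (B + absz i).+1); nia.
Qed.

Lemma eigen_coef i : (forall i, r *: t i = (g i)%:A *: t (i + 0)) ->
  (v : laurent F)@_i != 0 -> g i = c.
Proof.
move=> hr vi; apply: (mulIf vi).
by rewrite -(mcoeff_shift hr v i) rv qrepC mcoeffZ addr0.
Qed.

(** Here injectivity says that the eigenvalues of a diagonal element are simple.
*)
Lemma eigen_line i : (forall i, r *: t i = (g i)%:A *: t (i + 0)) ->
  injective g -> g i = c -> v = ((v : laurent F)@_i)%:A *: t i.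
Proof.
move=> hr g_inj gi; rewrite qrepC; apply/malgP => k; rewrite mcoeffZ mcoeffU.
case: (i =P k) => [->|ik]; first by rewrite mulr1.
rewrite mulr0; apply/eqP/negPn/negP => /(eigen_coef hr) gk.
by apply: ik; apply: g_inj; rewrite gi gk.
Qed.
End Spectrum.

(** * Parameters of isomorphic representations *)

Lemma rep_iso_params (F : fieldType) (q : F) (q0 : q != 0)
    (q_nroot1 : forall k : nat, (0 < k)%N -> q ^+ k != 1)
    (m n : nat) (m_gt0 : (0 < m)%N) (n_gt0 : (0 < n)%N) (cmn : gcdn m n = 1%N)
    (f : int -> F) (f0 : forall i : int, f i != 0)
    (hf : forall i : int, f (i + n%:Z) = q * f i)
    (m' n' : nat) (f' : int -> F) (f'0 : forall i : int, f' i != 0)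
    (hf' : forall i : int, f' (i + n'%:Z) = q * f' i) :
  rep_iso (qrep m n f hf) (qrep m' n' f' hf') ->
  [/\ m = m', n = n' & exists k : int, sconst m' n' f' = q ^ k * sconst m n f].
Proof.
move=> [phi [psi phiK psiK]].
have q_inj : injective (exprz q).
  suff q_lt (a b : int) : q ^ a = q ^ b -> a <= b.
    by move=> a b e; apply/eqP; rewrite Order.POrderTheory.eq_le !q_lt.
  move=> e; rewrite Order.TotalTheory.leNgt; apply/negP => ab.
  have /negP := q_nroot1 (absz (a - b)) ltac:(lia); apply.
  rewrite exprnP gez0_abs; last by lia.
  by rewrite expfzDr // e -expfzDr // subrr expr0z.
pose t' := qrep_t m' n' f' hf'; pose t := qrep_t m n f hf.
pose w := monom q m n.
pose S := step_prod f m n; pose g := step_prod f' m' n.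
have S0 i : S i != 0 by apply: step_prod_neq0.
have SE (k : int) : S k = q ^ k * S 0.
  by rewrite -[k in LHS]add0r /S (step_prod_shift q0 cmn f0 hf).
have S_inj : injective S.
  move=> a b; rewrite [S a]SE [S b]SE => /(mulIf (S0 0)); exact: q_inj.
have psiZ (r : qplane q) v : psi (r *: v) = r *: psi v.
  by apply: (can_inj phiK); rewrite psiK linearZ /= psiK.
have wt i : w *: t i = (S i)%:A *: t (i + 0) by exact: monom_diag.
have shift0 : (m * n')%N%:Z - (n * m')%N%:Z = 0.
  apply: (@eigen_shift_eq0 F q m' n' f' hf' w g (S 0) (phi (t 0))).
  - by rewrite -linearZ /= wt addr0 linearZ.
  - by move=> i; apply: step_prod_neq0.
  - by move=> i; rewrite monom_tpow; congr (_ *: qrep_t _ _ _ _ _); lia.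
  apply/eqP => e; have /eqP := @tpow_neq0 F q m n f hf 0; apply.
  by apply: (can_inj phiK); rewrite e linear0.
(* m n' = n m' and m, n coprime: (m', n') is a multiple of (m, n). *)
have [d hm] : exists d, m' = (d * m)%N.
  apply/dvdnP; have: (m %| n * m')%N by rewrite (_ : n * m' = m * n')%N ?dvdn_mulr //; lia.
  by rewrite Gauss_dvdr // /coprime cmn.
have hn : n' = (d * n)%N by nia.
have wt' i : w *: t' i = (g i)%:A *: t' (i + 0).
  by rewrite monom_tpow; congr (_ *: qrep_t _ _ _ _ _); lia.
have gE (i k : int) : g (i + k * d%:Z) = q ^ k * g i.
  by rewrite /g hm; apply: step_prod_quasi => // a; rewrite -hn hf'.
have w_psi i : w *: psi (t' i) = (g i)%:A *: psi (t' i).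
  by rewrite -psiZ wt' addr0 psiZ.
have psi_neq0 i : psi (t' i) != 0.
  apply/eqP => e; have /eqP := @tpow_neq0 F q m' n' f' hf' i; apply.
  by rewrite -/t' -[RHS](linear0 phi) -e psiK.
have spec i : exists k, S k = g i.
  have [k hk] := laurent_neq0 (psi_neq0 i).
  by exists k; apply: (eigen_coef (w_psi i) wt hk).
(* Every eigenvalue of w on V' is one of V; two of them, at the exponents 0 and
   1, differ by the power q^(b - a), which on V' is also the ratio of the
   eigenvalues at the exponents 0 and (b - a) d. *)
have [a ha] := spec 0; have [b hb] := spec 1.
have gd : g ((b - a) * d%:Z) = g 1.
  have := gE 0 (b - a); rewrite add0r => ->.
  by rewrite -ha -hb SE [S b]SE mulrA -expfzDr // subrK.
have d1 : d = 1%N.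
  (* t'^1 and t'^((b - a) d) correspond to vectors of the same eigenline of w on
     V, so they are proportional, which forces (b - a) d = 1. *)
  have h1 := eigen_line (w_psi 1) wt S_inj hb.
  have h2 := eigen_line (w_psi ((b - a) * d%:Z)) wt S_inj (etrans hb (esym gd)).
  pose x1 := (psi (t' 1) : laurent F)@_b.
  pose x2 := (psi (t' ((b - a) * d%:Z)) : laurent F)@_b.
  have x2_neq0 : x2 != 0.
    apply: contraNneq (psi_neq0 ((b - a) * d%:Z)) => e.
    by rewrite h2 -/x2 e scale0r scale0r.
  have h : x2%:A *: t' 1 = x1%:A *: t' ((b - a) * d%:Z).
    apply: (can_inj psiK); rewrite !psiZ h1 h2 -/x1 -/x2.
    by rewrite !qplane_algA mulrC.
  have := congr1 (fun v : qrep m' n' f' hf' => (v : laurent F)@_1) h.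
  rewrite /= !qrepC !mcoeffZ !mcoeffU eqxx mulr1.
  case: eqP => [e _|_ /eqP]; last by rewrite mulr0 (negPf x2_neq0).
  by have := congr1 absz e; rewrite abszM => /eqP; rewrite muln_eq1 => /andP[_ /eqP].
rewrite !sconstE hm hn d1 !mul1n; split => //; exists a.
by rewrite -/(S 0) -SE ha /g hm d1 mul1n.
Qed.

(** * Annihilator and classification *)

Theorem proposition2p4 (F : fieldType) (q : F)
    (q_neq0 : q != 0) (q_nroot1 : forall k : nat, (0 < k)%N -> q ^+ k != 1)
    (m n : nat) (m_gt0 : (0 < m)%N) (n_gt0 : (0 < n)%N)
    (coprime_mn : gcdn m n = 1%N)
    (f : int -> F) (f_neq0 : forall i : int, f i != 0)
    (hf : forall i : int, f (i + n%:Z) = q * f i) :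
  let s := sconst m n f in
  let z : qplane q := qX q ^+ m * qY q ^+ n - s%:A in
  (annihilator (qrep_t m n f hf 0) =i left_ideal z /\
   rep_iso (qrep m n f hf) (lquot (left_ideal z))) /\
  (forall (m' n' : nat) (m'_gt0 : (0 < m')%N) (n'_gt0 : (0 < n')%N)
     (f' : int -> F) (f'_neq0 : forall i : int, f' i != 0)
     (hf' : forall i : int, f' (i + n'%:Z) = q * f' i),
   rep_iso (qrep m n f hf) (qrep m' n' f' hf') <->
   [/\ m = m', n = n' & exists k : int, sconst m' n' f' = q ^ k * s]).
Proof.
move=> s z.
have zE : z = eigen_gen q m n (step_prod f m n 0) by rewrite -sconstE.
split.
  split; first by rewrite zE; apply: annihilator_tpow.
  apply: (cyclic_iso q_neq0 m_gt0 n_gt0 coprime_mn f_neq0 hf (j := 0)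
            (e := lquot_pi (left_ideal z) (1 : (qplane q)^o))) => [x|r].
    exists (repr (x : Quotient.quot (lquot_sub (left_ideal z)))).
    by rewrite -lquot_piZ [_ *: _]mulr1 lquot_reprK.
  by rewrite zE; apply: lquot_gen_eq0.
move=> m' n' m'_gt0 n'_gt0 f' f'_neq0 hf'; split.
  exact: rep_iso_params.
case=> em en [k hk]; subst m' n'.
have ek : step_prod f' m n (- k) = step_prod f m n 0.
  rewrite -[- k]add0r (step_prod_shift q_neq0 coprime_mn f'_neq0 hf') -!sconstE.
  rewrite hk mulrA -expfzDr //.
  by rewrite addNr expr0z mul1r.
apply: (cyclic_iso q_neq0 m_gt0 n_gt0 coprime_mn f_neq0 hf (j := 0)
          (e := qrep_t m n f' hf' (- k))) => [x|r].
  exact: tpow_gen.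
rewrite -ek -(annihilator_tpow q_neq0 m_gt0 n_gt0 coprime_mn f'_neq0 hf').
by split=> [/eqP|/eqP].
Qed.
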